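(* Let $X$ be a graph in an association scheme $\{A_0,\ldots,A_d\}$ containing a permutation matrix of order two, say the class $A_q$, with spectral decomposition $A_q=\sum_{s=0}^d\sigma_sE_s$, where $\{E_0,\ldots,E_d\}$ are the minimal idempotents of the scheme. Let $X$ have integer eigenvalues $\theta_0\ge\cdots\ge\theta_d$, define $g=\gcd\{\theta_0-\theta_s\}_{s=1}^d$, and let $h$ be the integer satisfying $hg=\gcd\{\theta_r-\theta_s\}_{\sigma_r=\sigma_s}$. Then: (a) $h=1$ if and only if the graph $X$ does not admit fractional revival nor perfect state transfer. (b) $h>2$ if and only if the graph $X$ admits fractional revival that is different from perfect state transfer. In particular, $\frac{2\pi}{hg}$ is the minimum time when fractional revival occurs in $X$. (c) $h$ is even if and only if the graph $X$ admits perfect state transfer. In particular, when $h=2$, $X$ admits perfect state transfer but no other form of fractional revival. (d) $h$ is doubly even (divisible by $4$) if and only if the graph $X$ admits balanced fractional revival.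
   Context: A (symmetric) association scheme is a set of $n\times n$ symmetric $01$-matrices $\{A_0,\ldots,A_d\}$ (its classes) with $A_0=I$, $\sum_iA_i=J$ (the all-ones matrix), and every product $A_iA_j$ a linear combination of $A_0,\ldots,A_d$. The $A_i$ span a commutative algebra (the Bose-Mesner algebra), which also has a basis $E_0,\ldots,E_d$ of minimal idempotents, the orthogonal projections onto the common eigenspaces; $E_0=\frac1nJ$. A graph $X$ is in the scheme if its adjacency matrix $A$ is a sum of some of the classes; $\theta_s$ is the eigenvalue of $A$ on $E_s$. With $U(t)=e^{-\mathrm{i}tA}$, fractional revival from a vertex $a$ to a vertex $b\ne a$ at time $\tau>0$ means $U(\tau)\mathbf{e}_a=\alpha\mathbf{e}_a+\beta\mathbf{e}_b$ for some $\alpha,\beta\in\mathbb{C}$ with $\beta\neq0$ and $|\alpha|^2+|\beta|^2=1$, where $\mathbf{e}_a$ is the standard basis vector indexed by $a$. It is perfect state transfer if $\alpha=0$, and balanced if $|\alpha|=|\beta|=1/\sqrt2$.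
   Formalization: X is assumed to have an edge (g≠0); the equivalence in (b) is stated for h≠0 (false for K_2); revival is taken between vertices matched by A_q, or between any vertices if A_q is the only class that is a permutation matrix of order two (otherwise false, e.g. C_4). *)

(* Defs.v *)
From HB Require Import structures.
From mathcomp Require Import all_boot all_order all_algebra all_fingroup.
From mathcomp Require Import all_classical all_reals all_analysis.
From mathcomp Require Import complex.

Set Implicit Arguments.
Unset Strict Implicit.
Unset Printing Implicit Defensive.

Import Order.TTheory GRing.Theory Num.Theory numFieldNormedType.Exports.
Local Open Scope ring_scope.
Local Open Scope complex_scope.

Section Schemes.
Variables (R : realType) (n d : nat).
Local Notation C := R[i].
Implicit Types (A E : 'I_d.+1 -> 'M[C]_n) (X : 'M[C]_n).

Definition bose_mesner A : {vspace 'M[C]_n} := <<codom A>>%VS.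

(* The nonvanishing of the classes makes A_0, ..., A_d linearly independent,
   so that the algebra has dimension d + 1. *)
Record association_scheme A : Prop := AssociationScheme {
  scheme_01 : forall k i j, A k i j = 0 \/ A k i j = 1;
  scheme_neq0 : forall k, A k != 0;
  scheme_sym : forall k, (A k)^T = A k;
  scheme_id : A ord0 = 1%:M;
  scheme_sum : \sum_k A k = const_mx 1;
  scheme_mul : forall j k, A j *m A k \in bose_mesner A
}.

Definition minimal_idempotent A (F : 'M[C]_n) : Prop :=
  [/\ F \in bose_mesner A, F != 0, F *m F = F
    & forall G, G \in bose_mesner A -> G *m G = G -> F *m G = G ->
      G = 0 \/ G = F].

Record scheme_idempotents A E : Prop := SchemeIdempotents {
  idem_min : forall s, minimal_idempotent A (E s);
  idem_basis : basis_of (bose_mesner A) (codom E);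
  idem_0 : E ord0 = const_mx n%:R^-1
}.

(* The class A_0 = I is left out because graphs have no loops. *)
Definition graph_in_scheme A X : Prop :=
  exists S : {set 'I_d.+1}, ord0 \notin S /\ X = \sum_(k in S) A k.

Definition perm_order2_mx (M : 'M[C]_n) : Prop :=
  exists s : 'S_n, #[s]%g = 2%N /\ M = perm_mx s.

End Schemes.

Section GcdDiff.
Variable d : nat.
Implicit Type theta : 'I_d.+1 -> int.

Definition gcd_diff0 theta : int :=
  \big[gcdz/0]_(s | s != ord0) (theta ord0 - theta s).

Definition gcd_diff_same (T : eqType) (sigma : 'I_d.+1 -> T) theta : int :=
  \big[gcdz/0]_r \big[gcdz/0]_(s | sigma r == sigma s) (theta r - theta s).

End GcdDiff.

Section Walk.
Variables (R : realType) (n : nat).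
Local Notation C := R[i].
Implicit Types (X M : 'M[C]_n) (a b : 'I_n) (t : R) (D : rel 'I_n).

(* The topology of R[i] as a normed field is carried by its alias R[i]^o. *)
Definition expmx M : 'M[C]_n :=
  \matrix_(i, j) limn (series (fun k => (k`!%:R^-1 *: M ^+ k) i j : C^o)).

Definition transition X t : 'M[C]_n := expmx (- ('i * t%:C) *: X).

Definition vertex_state a : 'cV[C]_n := delta_mx a 0.

Definition fractional_revival X a b t (alpha beta : C) : Prop :=
  [/\ 0 < t, a != b, beta != 0, `|alpha| ^+ 2 + `|beta| ^+ 2 = 1
    & transition X t *m vertex_state a
      = alpha *: vertex_state a + beta *: vertex_state b].

Definition any_revival (alpha beta : C) : Prop := True.
Definition perfect_transfer (alpha beta : C) : Prop := alpha = 0.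
Definition not_perfect_transfer (alpha beta : C) : Prop := alpha != 0.
Definition balanced (alpha beta : C) : Prop :=
  `|alpha| = (sqrtC 2)^-1 /\ `|beta| = (sqrtC 2)^-1.

(* Fractional revival of kind P occurs at time t, from a to b for some pair
   (a, b) in the set D of pairs of vertices under consideration. *)
Definition revival_at X D (P : C -> C -> Prop) t : Prop :=
  exists a b alpha beta,
    [/\ D a b, fractional_revival X a b t alpha beta & P alpha beta].

Definition admits X D P : Prop := exists t, revival_at X D P t.

Definition min_time (Q : R -> Prop) t : Prop :=
  Q t /\ forall u, Q u -> t <= u.

End Walk.

Arguments any_revival {R}.
Arguments perfect_transfer {R}.
Arguments not_perfect_transfer {R}.
Arguments balanced {R}.

(* Main.v *)
(* Put z = e^{-it}, so that U(t) = \sum_s z^theta_s E_s lies in the Bose-Mesner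
   algebra. If U(t) e_a is supported on {a, b}, then, all classes being regular,
   U(t) = alpha I + beta A_m with A_m a class of valency 1, and m = q. Reading off
   eigenvalues, revival at t means z^theta_s = alpha + beta sigma_s for all s,
   where sigma_0 = 1 and sigma takes both values 1 and -1. This is solvable in
   alpha and beta <> 0 exactly when z^(hg) = 1 and z^g <> 1. Hence everything is
   governed by w = z^g = e^{-itg}: revival is w^h = 1 <> w, perfect state transfer
   is in addition w = -1, and balanced revival is in addition w^2 = -1. *)

Require Import Defs.
From HB Require Import structures.
From mathcomp Require Import all_boot all_order all_algebra all_fingroup.
From mathcomp Require Import all_classical all_reals all_analysis.
From mathcomp Require Import complex cyclic ring lra zify.

Set Implicit Arguments.
Unset Strict Implicit.
Unset Printing Implicit Defensive.

Import Order.TTheory GRing.Theory Num.Theory numFieldNormedType.Exports.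
Local Open Scope ring_scope.
Local Open Scope complex_scope.

(** * Points of the unit circle *)

Section Cis.
Variable R : realType.
Implicit Types x y : R.

Definition cis y : R[i] := cos y +i* sin y.

Lemma cisD x y : cis (x + y) = cis x * cis y.
Proof. by rewrite /cis cosD sinD; simpc; rewrite [X in _ +i* X]addrC. Qed.

Lemma cis0 : cis 0 = 1.
Proof. by rewrite /cis cos0 sin0. Qed.

Lemma normr_cis y : `|cis y| = 1.
Proof. by rewrite normc_def /= cos2Dsin2 sqrtr1. Qed.

Lemma cis_neq0 y : cis y != 0.
Proof. by rewrite -normr_eq0 normr_cis oner_eq0. Qed.

Lemma cisN y : cis (- y) = (cis y)^-1.
Proof.
by apply: (mulIf (cis_neq0 y)); rewrite -cisD addNr cis0 mulVf ?cis_neq0.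
Qed.

Lemma cisMz y (k : int) : cis (y * k%:~R) = cis y ^ k.
Proof.
have cisMn (n : nat) : cis (y * n%:R) = cis y ^+ n.
  elim: n => [|n IHn]; first by rewrite mulr0 cis0.
  by rewrite -natr1 mulrDr mulr1 cisD IHn exprSr.
case: k => n; first exact: cisMn.
by rewrite NegzE mulrNz mulrN cisN cisMn -exprnN.
Qed.

Lemma cis_pi : cis pi = -1.
Proof.
by rewrite /cis cospi sinpi; apply/eqP; rewrite eq_complex /= oppr0 !eqxx.
Qed.

Lemma cis_2pi : cis (2 * pi) = 1.
Proof. by rewrite mulr_natl mulr2n cisD cis_pi mulrNN mulr1. Qed.

(** For 0 < y < 2 pi the sine of y / 2 is positive, so cos y = 1 - 2 sin^2 (y / 2) is below 1. This
    bounds revival times from below. *)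
Lemma cis_eq1_ge y : 0 < y -> cis y = 1 -> 2 * pi <= y.
Proof.
move=> y_gt0 [cos1 _]; rewrite leNgt; apply/negP => ylt.
have sin_gt0 : 0 < sin (y / 2).
  by apply: sin_gt0_pi; rewrite divr_gt0 //= ltr_pdivrMr // mulrC.
have : cos ((y / 2) *+ 2) = 1 by rewrite -mulr_natr divfK ?pnatr_eq0.
rewrite cos_mulr2n cos2sin2; have := exprn_gt0 2 sin_gt0; lra.
Qed.

End Cis.

(** * The matrix exponential on a spectral decomposition *)

Section Exponential.
Local Open Scope classical_set_scope.

Lemma cvg_complex (R : realType) (u v : R^nat) (a b : R) :
  u @ \oo --> a -> v @ \oo --> b ->
  (fun k => u k +i* v k : R[i]^o) @ \oo --> (a +i* b : R[i]^o).
Proof.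
move=> /cvgrPdist_lt ua /cvgrPdist_lt vb.
(* Positivity in [R[i]] forces the tolerance to be real, so it suffices to hold each part within e /
   2. *)
apply/cvgrPdist_lt => -[e e']; rewrite ltcE /= => /andP[/eqP-> e_gt0].
have e2_gt0 : 0 < e / 2 by rewrite divr_gt0.
have uan := ua _ e2_gt0; have vbn := vb _ e2_gt0.
near=> k; have uk : `|a - u k| < e / 2 by near: k.
have vk : `|b - v k| < e / 2 by near: k.
have -> : (a +i* b : R[i]) - (u k +i* v k) = (a - u k)%:C + 'i * (b - v k)%:C.
  by simpc.
apply: le_lt_trans (ler_normD _ _) _.
rewrite normrM !normc_def /= expr0n /= expr1n add0r addr0 sqrtr1 mul1r addr0.
by rewrite !sqrtr_sqr ltcE /= addr0 eqxx (splitr e) ltrD.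
Unshelve. all: by end_near. Qed.

Lemma cvg_series_cis (R : realType) (y : R) :
  series (fun k => k`!%:R^-1 * ('i * y%:C) ^+ k : R[i]^o) @ \oo
    --> (cis y : R[i]^o).
Proof.
have coeffE k : k`!%:R^-1 * ('i * y%:C) ^+ k = cos_coeff y k +i* sin_coeff y k.
  rewrite exprMn -[k in 'i ^+ k]odd_double_half exprD -mul2n exprM sqr_i.
  rewrite -rmorphXn -(rmorph_nat (real_complex R)) -fmorphV.
  rewrite -(rmorphN1 (real_complex R)) -rmorphXn /cos_coeff /sin_coeff /=.
  case: (boolP (odd k)) => ok /=.
    (* The sign exponent in [sin_coeff] is k.-1./2, which agrees with k./2 for odd k. *)
    have -> : k.-1./2 = k./2 by rewrite -{1}(odd_double_half k) ok doubleK.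
    by simpc; congr (_ +i* _); exact: mulrC.
  by simpc; congr (_ +i* _); exact: mulrC.
have -> : series (fun k => k`!%:R^-1 * ('i * y%:C) ^+ k : R[i]^o) =
    (fun k => series (cos_coeff y) k +i* series (sin_coeff y) k).
  apply/funext => k; rewrite /series /=.
  elim: k => [|k IHk]; first by rewrite !big_geq.
  by rewrite !big_nat_recr //= {}IHk coeffE; simpc.
apply: cvg_complex.
  by rewrite unlock; exact: is_cvg_series_cos_coeff.
by rewrite unlock; exact: is_cvg_series_sin_coeff.
Qed.

(** Applying M repeatedly to the decomposition of the identity gives its powers, and each entry of
    the exponential series becomes a finite combination of scalar series for [cis]. *)
Lemma expmx_spectral (R : realType) (n m : nat) (E : 'I_m -> 'M[R[i]]_n)
    (y : 'I_m -> R) (M : 'M[R[i]]_n) :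
  \sum_s E s = 1%:M -> (forall s, M *m E s = ('i * (y s)%:C) *: E s) ->
  expmx M = \sum_s cis (y s) *: E s.
Proof.
move=> sumE ME; have MX k : M ^+ k = \sum_s ('i * (y s)%:C) ^+ k *: E s.
  elim: k => [|k IHk].
    by rewrite expr0 -[LHS]sumE; apply: eq_bigr => s _; rewrite expr0 scale1r.
  rewrite exprS {}IHk -mulmxE mulmx_sumr; apply: eq_bigr => s _.
  by rewrite -scalemxAr ME scalerA exprSr.
apply/matrixP => i j; rewrite mxE summxE.
have -> : series (fun k => (k`!%:R^-1 *: M ^+ k) i j : R[i]^o) =
    (fun k => \sum_s series (fun k => k`!%:R^-1 * ('i * (y s)%:C) ^+ k : R[i]^o) k
                * E s i j).
  apply/funext => k; rewrite /series /=.
  under [RHS]eq_bigr do rewrite mulr_suml.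
  rewrite exchange_big /=; apply: eq_bigr => l _.
  rewrite MX mxE summxE mulr_sumr; apply: eq_bigr => s _.
  by rewrite mxE mulrA.
apply: (@cvg_lim (R[i]^o)); first exact: norm_hausdorff.
under [X in _ --> X]eq_bigr do rewrite mxE.
apply: cvg_big => [|s _]; first exact: add_continuous.
by apply: cvgMr_tmp; exact: cvg_series_cis.
Qed.

End Exponential.

(** * Greatest common divisors as exponents *)

Lemma biggcdz_dvd (I : finType) (P : pred I) (F : I -> int) (i : I) :
  P i -> (\big[gcdz/0]_(j | P j) F j %| F i)%Z.
Proof.
move=> Pi; have := mem_index_enum i; elim: (index_enum I) => // j r IHr.
rewrite in_cons big_cons => /orP[/eqP<-|/IHr dvdF].
  by rewrite Pi dvdz_gcdl.
by case: ifP => // _; apply: dvdz_trans dvdF; rewrite dvdz_gcdr.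
Qed.

Lemma biggcdz_ge0 (I : finType) (P : pred I) (F : I -> int) :
  0 <= \big[gcdz/0]_(j | P j) F j.
Proof. by elim/big_rec: _. Qed.

(** The exponents sending z to 1 form an ideal of the integers, so Bezout's identity applies. *)
Lemma exprz_gcd_eq1 (F : fieldType) (z : F) (k l : int) :
  z != 0 -> z ^ k = 1 -> z ^ l = 1 -> z ^ gcdz k l = 1.
Proof.
move=> z_neq0 zk zl; have [u [v <-]] := Bezoutz k l.
by rewrite expfzDr // [u * k]mulrC [v * l]mulrC -!exprz_exp zk zl !exp1rz mulr1.
Qed.

Lemma exprz_biggcd_eq1 (F : fieldType) (z : F) (I : finType) (P : pred I)
    (f : I -> int) :
  z != 0 -> (forall i, P i -> z ^ f i = 1) -> z ^ (\big[gcdz/0]_(i | P i) f i) = 1.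
Proof.
move=> z_neq0 zf; elim/big_ind: _ => // k l; exact: exprz_gcd_eq1.
Qed.

Lemma span_codom_sum (K : fieldType) (vT : vectType K) (I : finType)
    (f : I -> vT) (v : vT) :
  v \in <<codom f>>%VS -> exists c, v = \sum_i c i *: f i.
Proof.
rewrite span_def big_image /= => /memv_sumP[vs vsP ->].
have vs_line i : exists c, vs i = c *: f i by apply/vlineP/vsP.
have [c cP] := fin_all_exists vs_line.
by exists c; apply: eq_bigr.
Qed.

(** * Combinatorics of the classes *)

Section Scheme.
Variables (R : realType) (n d : nat) (A E : 'I_d.+1 -> 'M[R[i]]_n).
Hypothesis schemeA : association_scheme A.
Local Notation BM := (bose_mesner A).

Lemma mem_class k : A k \in BM.
Proof. by apply: memv_span; exact: codom_f. Qed.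

(** The entries at (i, j) are 0 or 1 and add up to 1 because the classes sum to J. The Kronecker
    form gives all of them in one rewrite. *)
Lemma class_of (i j : 'I_n) : exists k, forall l, A l i j = (l == k)%:R.
Proof.
have A_ge0 l : 0 <= A l i j by case: (scheme_01 schemeA l i j) => ->.
have sumA : \sum_l A l i j = 1.
  by rewrite -summxE (scheme_sum schemeA) mxE.
have [[k Ak]|A0] := pselect (exists k, A k i j = 1); last first.
  suff /eqP : \sum_l A l i j = 0 by rewrite sumA oner_eq0.
  apply: big1 => l _; have [//|Al] := scheme_01 schemeA l i j.
  by case: A0; exists l.
exists k => l; have [->//|lk] := eqVneq l k.
move: sumA; rewrite (bigD1 k) //= Ak => /eqP.
rewrite -subr_eq0 addrAC subrr add0r psumr_eq0 // => /allP /(_ l).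
by rewrite mem_index_enum lk => /(_ isT) /eqP.
Qed.

Lemma bose_mesner_sym F : F \in BM -> F^T = F.
Proof.
move=> /span_codom_sum[c ->]; rewrite linear_sum; apply: eq_bigr => k _.
by rewrite linearZ /= (scheme_sym schemeA).
Qed.

Lemma bose_mesner_mul F G : F \in BM -> G \in BM -> F *m G \in BM.
Proof.
move=> /span_codom_sum[c ->] /span_codom_sum[e ->].
rewrite mulmx_suml memv_suml // => k _; rewrite mulmx_sumr memv_suml // => l _.
by rewrite -scalemxAr -scalemxAl !memvZ // (scheme_mul schemeA).
Qed.

(** The product is itself symmetric, and transposition reverses it. *)
Lemma bose_mesner_mulC F G : F \in BM -> G \in BM -> F *m G = G *m F.
Proof.
move=> FA GA; rewrite -[LHS]bose_mesner_sym ?bose_mesner_mul // trmx_mul.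
by rewrite !bose_mesner_sym.
Qed.

(* Multiplying by the all-ones matrix J stays in the algebra, hence is
   symmetric, which makes row sums constant. *)
Lemma row_sum_const k i i' : \sum_j A k i j = \sum_j A k i' j.
Proof.
have J_A : const_mx 1 \in BM.
  by rewrite -(scheme_sum schemeA) memv_suml // => l _; exact: mem_class.
have := bose_mesner_sym (bose_mesner_mul (mem_class k) J_A).
move=> /matrixP /(_ i' i); rewrite !mxE.
by under eq_bigr do rewrite mxE mulr1; under [RHS]eq_bigr do rewrite mxE mulr1.
Qed.

Lemma class_sym k i j : A k i j = A k j i.
Proof. by rewrite -[in LHS](scheme_sym schemeA) mxE. Qed.

(** An empty column is by symmetry an empty row; row sums being constant and entries nonnegative,
    the whole class would vanish. *)
Lemma class_neighbour k j : exists i, A k i j = 1.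
Proof.
apply: contrapT => noi; have Aj i : A k i j = 0.
  by have [//|Ai] := scheme_01 schemeA k i j; case: noi; exists i.
have /negP[] := scheme_neq0 schemeA k; apply/eqP/matrixP => i l; rewrite mxE.
apply/eqP; move: (row_sum_const k i j).
rewrite [RHS]big1 => [|l' _]; last by rewrite class_sym.
move/eqP; rewrite psumr_eq0 => [/allP/(_ l)|l' _].
  by rewrite mem_index_enum; exact.
by have [->|->] := scheme_01 schemeA k i l'.
Qed.

Lemma class_diag k i : A k i i = (k == ord0)%:R.
Proof.
have [l Al] := class_of i i; rewrite Al; congr (_ == _)%:R.
have := Al ord0; rewrite (scheme_id schemeA) mxE eqxx.
by case: eqVneq => [->//|_] /eqP; rewrite oner_eq0.
Qed.

(* Row sums being constant, a class in which one vertex has a single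
   neighbour is the matching of every vertex with its only neighbour. *)
Lemma class_perm_order2 k (a b : 'I_n) :
  k != ord0 -> (forall x, A k x a = 1 -> x = b) -> perm_order2_mx (A k).
Proof.
move=> k_neq0 Aa.
have nat_row i : \sum_j A k i j = #|[pred j | A k i j == 1]|%:R.
  rewrite -sum1_card natr_sum [RHS]big_mkcond; apply: eq_bigr => j _.
  rewrite inE; have [->|->] := scheme_01 schemeA k i j; last by rewrite eqxx.
  by rewrite eq_sym oner_eq0.
have row1 i : #|[pred j | A k i j == 1]| = 1%N.
  apply/eqP; rewrite -(eqr_nat R[i]) -nat_row (row_sum_const k i a) nat_row.
  rewrite eqr_nat; apply/eqP; apply: etrans (card1 b).
  apply: eq_card => j; rewrite !inE.
  have [x Ax] := class_neighbour k a.
  by rewrite class_sym; apply/eqP/eqP => [/Aa //|->]; rewrite -(Aa x).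
have [f fP] : exists f : 'I_n -> 'I_n, forall i j, (A k i j == 1) = (j == f i).
  have ex i : exists x, forall j, (A k i j == 1) = (j == x).
    by have /mem_card1[x xP] := row1 i; exists x => j; have := xP j; rewrite !inE.
  by have [f fP] := fin_all_exists ex; exists f.
(* The class is symmetric, so being the only neighbour is mutual. *)
have fK : involutive f.
  by move=> i; apply/eqP; rewrite eq_sym -fP class_sym fP.
have AE : A k = perm_mx (perm (inv_inj fK)).
  apply/matrixP => i j; rewrite !mxE permE eq_sym -fP.
  by have [->|->] := scheme_01 schemeA k i j; rewrite ?eqxx // eq_sym oner_eq0.
exists (perm (inv_inj fK)); split=> //; apply: nt_prime_order => //.
  by apply/permP => i; rewrite expgS expg1 permM !permE fK.
(* A trivial permutation would put ones on the diagonal, where only [A ord0] has them. *)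
apply: contra_neq k_neq0 => s1; have := class_diag k a.
rewrite AE s1 perm_mx1 mxE eqxx; case: eqVneq => // _ /eqP.
by rewrite oner_eq0.
Qed.

End Scheme.

(** * Signs, fourth roots of unity and moduli *)

Lemma oppr1_neq1 (F : numFieldType) : -1 != 1 :> F.
Proof. by rewrite -subr_eq0 -opprD oppr_eq0 -mulr2n pnatr_eq0. Qed.

Lemma signr_eq1 (F : numFieldType) (m : nat) : (-1) ^+ m = 1 :> F -> ~~ odd m.
Proof.
by rewrite -signr_odd; case: (odd m) => // /eqP; rewrite (negPf (oppr1_neq1 F)).
Qed.

(** Two parity arguments: (x^2)^m = 1 makes m even, and then (x^2)^(m/2) = 1 makes m/2 even. *)
Lemma expr_eq1_dvd4 (F : numFieldType) (x : F) (m : nat) :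
  x ^+ 2 = -1 -> x ^+ m = 1 -> (4 %| m)%N.
Proof.
move=> x2 xm; have /signr_eq1 m_even : (-1) ^+ m = 1 :> F.
  by rewrite -x2 -exprM mulnC exprM xm expr1n.
move: xm; rewrite -(even_halfK m_even) -muln2 mulnC exprM x2.
move=> /signr_eq1 half_even.
by rewrite -(even_halfK half_even) -muln2; lia.
Qed.

Lemma normr_exprz1 (K : numFieldType) (z : K) (k : int) :
  `|z| = 1 -> `|z ^ k| = 1.
Proof.
move=> z1; case: k => k; rewrite ?NegzE -?exprnN ?normfV.
  by rewrite normrX z1 expr1n.
by rewrite normrX z1 expr1n invr1.
Qed.

(** Both sides of the first equation are nonnegative, so they may be compared through their
    squares. *)
Lemma normr_half_eq (C : numClosedFieldType) (u v : C) :
  `|u| = 1 -> `|u * v / 2| = (sqrtC 2)^-1 <-> `|v| ^+ 2 = 2.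
Proof.
move=> u1; rewrite !normrM u1 mul1r normfV normr_nat.
have half : ((sqrtC 2)^-1 : C) ^+ 2 = 2 / 2 ^+ 2.
  by rewrite exprVn sqrtCK; field.
split=> [/(congr1 (fun x => x ^+ 2))|v2].
  rewrite half exprMn exprVn; apply: mulIf.
  by rewrite invr_eq0 expf_neq0 ?pnatr_eq0.
apply/eqP; rewrite -(@eqrXn2 _ 2) ?divr_ge0 ?invr_ge0 ?sqrtC_ge0 ?ler0n //.
by rewrite half exprMn exprVn v2.
Qed.

(** On the unit circle conjugation is inversion, whence |1 + w|^2 = 2 + (w^2 + 1) / w. *)
Lemma normr_add1_sqr (C : numClosedFieldType) (w : C) :
  `|w| = 1 -> `|1 + w| ^+ 2 = 2 <-> w ^+ 2 = -1.
Proof.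
move=> w1; have w_neq0 : w != 0 by rewrite -normr_eq0 w1 oner_eq0.
have -> : `|1 + w| ^+ 2 = (1 + w) * (1 + w^-1).
  by rewrite normCK rmorphD rmorph1 invC_norm w1 expr1n invr1 mul1r.
have -> : (1 + w) * (1 + w^-1) = 2 + (w ^+ 2 + 1) / w by field.
split=> [/eqP|->]; last by rewrite addNr mul0r addr0.
rewrite -subr_eq0 addrAC subrr add0r mulf_eq0 invr_eq0 (negPf w_neq0) orbF.
by rewrite addr_eq0 => /eqP.
Qed.

(** Replacing w by -w exchanges the two amplitudes and preserves w^2, so one modulus computation
    settles both. *)
Lemma balanced_half (R : realType) (u w : R[i]) : `|u| = 1 -> `|w| = 1 ->
  balanced (u * (1 + w) / 2) (u * (1 - w) / 2) <-> w ^+ 2 = -1.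
Proof.
move=> u1 w1; rewrite /balanced; split=> [[/(normr_half_eq _ u1)]|w2].
  by move/(normr_add1_sqr w1).
split; apply/(normr_half_eq _ u1); first exact/(normr_add1_sqr w1).
by apply/normr_add1_sqr; rewrite ?normrN ?sqrrN.
Qed.

Lemma exprz_dvd_eq1 (F : fieldType) (z : F) (k l : int) :
  (k %| l)%Z -> z ^ k = 1 -> z ^ l = 1.
Proof. by case/dvdzP=> m -> zk; rewrite mulrC -exprz_exp zk exp1rz. Qed.

(** * The two gcds as conditions on powers of z *)

Section GcdPowers.
Variables (F : fieldType) (T : eqType) (d : nat).
Variables (sigma : 'I_d.+1 -> T) (theta : 'I_d.+1 -> int).
Variables (z : F) (z_neq0 : z != 0).

Lemma exprz_eq_sub (k l : int) : z ^ k = z ^ l <-> z ^ (k - l) = 1.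
Proof.
rewrite expfzDr // -invr_expz; split=> [->|kl].
  by rewrite mulfV ?expfz_neq0.
by apply/divr1_eq; rewrite ?expfz_neq0.
Qed.

(** For z = e^{-it} the right-hand side says that U(t) is a scalar matrix, the case that revival
    excludes. *)
Lemma exprz_gcd_diff0 :
  z ^ gcd_diff0 theta = 1 <-> forall s, z ^ theta ord0 = z ^ theta s.
Proof.
split=> [zg s|zE].
  have [->//|s_neq0] := eqVneq s ord0.
  by apply/exprz_eq_sub/exprz_dvd_eq1/zg; exact: biggcdz_dvd.
by apply: exprz_biggcd_eq1 => // s _; apply/exprz_eq_sub.
Qed.

(** For z = e^{-it} the right-hand side says that the eigenvalue of U(t) on E_s depends only on that
    of A_q, so that U(t) is a combination of I and A_q. *)
Lemma exprz_gcd_diff_same : z ^ gcd_diff_same sigma theta = 1 <->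
  forall r s, sigma r = sigma s -> z ^ theta r = z ^ theta s.
Proof.
split=> [zG r s rs|zE].
  apply/exprz_eq_sub/exprz_dvd_eq1/zG.
  apply: dvdz_trans (biggcdz_dvd (i := r) _ _) _ => //.
  by apply: (biggcdz_dvd (P := fun s => sigma r == sigma s)); apply/eqP.
apply: exprz_biggcd_eq1 => // r _; apply: exprz_biggcd_eq1 => // s /eqP rs.
exact/exprz_eq_sub/zE.
Qed.

End GcdPowers.

(** Used to obtain |alpha|^2 + |beta|^2 = 1 once alpha + beta and alpha - beta have modulus 1. *)
Lemma parallelogram (C : numClosedFieldType) (x y : C) :
  `|x + y| ^+ 2 + `|x - y| ^+ 2 = 2 * (`|x| ^+ 2 + `|y| ^+ 2).
Proof. by rewrite !normCK !rmorphD rmorphN; ring. Qed.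

(** * Orthogonality of the minimal idempotents and the spectral form of U(t) *)

Section Idempotents.
Variables (R : realType) (n d : nat) (A E : 'I_d.+1 -> 'M[R[i]]_n).
Hypothesis schemeA : association_scheme A.
Hypothesis schemeE : scheme_idempotents A E.
Local Notation BM := (bose_mesner A).

Lemma mem_idem s : E s \in BM.
Proof. by case: (idem_min schemeE s). Qed.

Lemma idem_neq0 s : E s != 0.
Proof. by case: (idem_min schemeE s). Qed.

Lemma idem_inj : injective E.
Proof.
apply/injectiveP; rewrite /dinjectiveb -/(codom E).
exact: free_uniq (basis_free (idem_basis schemeE)).
Qed.

Lemma bose_mesner_idem F : F \in BM -> exists c, F = \sum_s c s *: E s.
Proof.
by rewrite -(span_basis (idem_basis schemeE)) => /span_codom_sum.
Qed.

(** For r != s the product is an idempotent below both factors. By minimality, if it is nonzero it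
    equals each of them, against the injectivity of E. *)
Lemma idem_mul r s : E r *m E s = if r == s then E r else 0.
Proof.
have idE k : E k *m E k = E k by case: (idem_min schemeE k).
case: eqVneq => [<-//|rs].
have ErsC : E r *m E s = E s *m E r.
  by apply: (bose_mesner_mulC schemeA); exact: mem_idem.
have Ers_A : E r *m E s \in BM.
  by apply: (bose_mesner_mul schemeA); exact: mem_idem.
have idErs : (E r *m E s) *m (E r *m E s) = E r *m E s.
  by rewrite {1}ErsC -mulmxA (mulmxA (E r)) idE mulmxA -ErsC -mulmxA idE.
have [_ _ _ minEr] := idem_min schemeE r.
have [_ _ _ minEs] := idem_min schemeE s.
have [//|Ers_r] : E r *m E s = 0 \/ E r *m E s = E r.
  by apply: minEr => //; rewrite mulmxA idE.
have [//|Ers_s] : E r *m E s = 0 \/ E r *m E s = E s.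
  by apply: minEs => //; rewrite {1}ErsC mulmxA idE.
by case/eqP: rs; apply: idem_inj; rewrite -Ers_r.
Qed.

Lemma sum_idem_mul c s : (\sum_r c r *: E r) *m E s = c s *: E s.
Proof.
rewrite mulmx_suml (bigD1 s) //= -scalemxAl idem_mul eqxx big1 ?addr0 //.
by move=> r rs; rewrite -scalemxAl idem_mul (negPf rs) scaler0.
Qed.

Lemma scaler_idem_inj s : injective (fun c : R[i] => c *: E s).
Proof.
move=> c e /eqP; rewrite -subr_eq0 -scalerBl scaler_eq0 (negPf (idem_neq0 s)).
by rewrite orbF subr_eq0 => /eqP.
Qed.

(** Expand the identity, which is the class A_0, in the basis E; multiplying by E s turns the s-th
    term into E s. *)
Lemma sum_idem : \sum_s E s = 1%:M.
Proof.
have : 1%:M \in BM by rewrite -(scheme_id schemeA); exact: mem_class.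
case/bose_mesner_idem => c c1; rewrite c1; apply: eq_bigr => s _.
by rewrite -sum_idem_mul -c1 mul1mx.
Qed.

Lemma eq_on_idem (F G : 'M[R[i]]_n) :
  (forall s, F *m E s = G *m E s) -> F = G.
Proof.
by move=> FG; rewrite -[F]mulmx1 -[G]mulmx1 -sum_idem !mulmx_sumr; apply: eq_bigr.
Qed.

(** Integer eigenvalues make every phase e^{-it theta_s} an integer power of the one number
    e^{-it}. *)
Lemma transition_spectral X (theta : 'I_d.+1 -> int) t :
  (forall s, X *m E s = (theta s)%:~R *: E s) ->
  transition X t = \sum_s cis (- t) ^ theta s *: E s.
Proof.
move=> XE; rewrite /transition.
rewrite (expmx_spectral (y := fun s => - t * (theta s)%:~R) sum_idem).
  by apply: eq_bigr => s _; rewrite cisMz.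
move=> s; rewrite -scalemxAl XE scalerA; congr (_ *: _).
by rewrite rmorphM rmorphN rmorph_int mulrA mulrN.
Qed.

End Idempotents.

(** * The matching A_q and the form of U(t) at a revival *)

Section Matching.
Variables (R : realType) (n d : nat) (A E : 'I_d.+1 -> 'M[R[i]]_n).
Variables (q : 'I_d.+1) (sigma : 'I_d.+1 -> R[i]).
Hypothesis schemeA : association_scheme A.
Hypothesis schemeE : scheme_idempotents A E.
Hypothesis matchingAq : perm_order2_mx (A q).
Hypothesis Aq_spectral : A q = \sum_s sigma s *: E s.

Lemma matching_involution : exists2 f : 'I_n -> 'I_n,
  (forall i j, A q i j = (f i == j)%:R) /\ involutive f & exists a, f a != a.
Proof.
have [s [os AE]] := matchingAq; exists s.
  split=> [i j|i]; first by rewrite AE !mxE.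
  have := expg_order s; rewrite os => /permP /(_ i).
  by rewrite expgS expg1 permM perm1.
apply: contrapT => s_id; have s1 : s = 1%g.
  apply/permP => i; rewrite perm1; apply/eqP/negPn/negP => si.
  by apply: s_id; exists i.
by move: os; rewrite s1 order1.
Qed.

Lemma matching_sqr : A q *m A q = 1%:M.
Proof.
have [f [Af fK] _] := matching_involution; apply/matrixP => i j.
rewrite !mxE (bigD1 (f i)) //= !Af eqxx mul1r fK big1 ?addr0 // => k.
by rewrite Af eq_sym => /negPf->; rewrite mul0r.
Qed.

Lemma matching_idem s : A q *m E s = sigma s *: E s.
Proof. by rewrite Aq_spectral (sum_idem_mul schemeA schemeE). Qed.

Lemma sigma_sqr s : sigma s ^+ 2 = 1.
Proof.
apply: (scaler_idem_inj schemeE (s := s)).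
rewrite scale1r -[RHS]mul1mx -matching_sqr -mulmxA matching_idem -scalemxAr.
by rewrite matching_idem scalerA.
Qed.

Lemma sigma_pm1 s : sigma s = 1 \/ sigma s = -1.
Proof.
have /eqP := sigma_sqr s.
by rewrite sqrf_eq1 => /orP[] /eqP; [left|right].
Qed.

(** Each row of A_q holds a single 1, so A_q fixes J, a multiple of which is E_0. *)
Lemma sigma_ord0 : sigma ord0 = 1.
Proof.
have [f [Af _] _] := matching_involution.
apply: (scaler_idem_inj schemeE (s := ord0)).
rewrite scale1r -matching_idem (idem_0 schemeE); apply/matrixP => i j.
rewrite !mxE (bigD1 (f i)) //= Af eqxx mul1r mxE big1 ?addr0 // => k.
by rewrite Af eq_sym => /negPf->; rewrite mul0r.
Qed.

(** Otherwise A_q would be the sum of all E_s, that is I, whereas the matching moves some vertex. *)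
Lemma sigma_neg1 : exists r, sigma r = -1.
Proof.
have [f [Af _] [a fa]] := matching_involution; apply: contrapT => no_neg1.
have Aq1 : A q = 1%:M.
  rewrite Aq_spectral -(sum_idem schemeA schemeE); apply: eq_bigr => s _.
  have [->|sigma_s] := sigma_pm1 s; first by rewrite scale1r.
  by case: no_neg1; exists s.
have := Af a a; rewrite Aq1 mxE eqxx (negPf fa) => /eqP.
by rewrite oner_eq0.
Qed.

Variables (X : 'M[R[i]]_n) (theta : 'I_d.+1 -> int) (D : rel 'I_n).
Hypothesis X_spectral : forall s, X *m E s = (theta s)%:~R *: E s.
Hypothesis D_matching : (forall a b, D a b = (A q a b == 1)) \/
  ((forall j, perm_order2_mx (A j) -> j = q) /\ forall a b, D a b).

(** Every class meets column a, so this single column determines all coefficients of U(t) in the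
    classes. *)
Lemma revival_matrix a b t alpha beta :
  D a b -> fractional_revival X a b t alpha beta ->
  transition X t = alpha%:M + beta *: A q.
Proof.
move=> Dab [_ ab beta_neq0 _ Ua].
have : transition X t \in bose_mesner A.
  rewrite (transition_spectral schemeA schemeE t X_spectral).
  by apply: memv_suml => s _; rewrite memvZ // (mem_idem schemeE).
case/span_codom_sum=> c Uc; have Uxa x k : A k x a = 1 -> transition X t x a = c k.
  move=> Ak; have [l Al] := class_of schemeA x a.
  have {Ak} kl : k = l.
    by apply/eqP; move/eqP: Ak; rewrite Al; case: (k == l); rewrite // eq_sym oner_eq0.
  rewrite Uc summxE (bigD1 l) //= mxE Al eqxx mulr1 kl big1 ?addr0 // => m.
  by rewrite mxE Al => /negPf->; rewrite mulr0.
have Ux x : transition X t x a = alpha * (x == a)%:R + beta * (x == b)%:R.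
  by move: Ua => /matrixP /(_ x 0); rewrite -colE !mxE eqxx !andbT.
have [m Am] := class_of schemeA b a.
have Am1 : A m b a = 1 by rewrite Am eqxx.
have cm : c m = beta.
  by rewrite -(Uxa b) // Ux eqxx eq_sym (negPf ab) mulr0 mulr1 add0r.
have A0a : A ord0 a a = 1 by rewrite (scheme_id schemeA) mxE eqxx.
have c0 : c ord0 = alpha.
  by rewrite -(Uxa a) // Ux eqxx (negPf ab) mulr0 mulr1 addr0.
have m_neq0 : m != ord0.
  apply: contraNneq ab => m0; move/eqP: Am1; rewrite m0 (scheme_id schemeA) mxE.
  by rewrite [a == b]eq_sym; case: (b == a); rewrite // eq_sym oner_eq0.
(* Any m-neighbour x of a has the entry beta != 0 in column a, hence lies in {a, b}, and a is
   excluded because m != 0. *)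
have Ama x : A m x a = 1 -> x = b.
  move=> Amx; apply/eqP; move: (Ux x); rewrite (Uxa x m) // cm.
  have -> : (x == a) = false.
    apply: contraTF (isT) => /eqP xa; move/eqP: Amx.
    by rewrite xa (class_diag schemeA) (negPf m_neq0) eq_sym oner_eq0.
  rewrite mulr0 add0r; case: eqP => // _; rewrite mulr0 => /eqP.
  by rewrite (negPf beta_neq0).
(* Either D already says that (a, b) is matched by A_q, or A_q is the only class of this shape. *)
have mq : m = q.
  case: D_matching => [DA|[uniq_q _]]; last first.
    by apply: uniq_q; exact: (class_perm_order2 schemeA) Ama.
  move: Dab; rewrite DA (class_sym schemeA) Am.
  by case: (q =P m) => // _; rewrite eq_sym oner_eq0.
rewrite Uc -mq (bigD1 ord0) //= (bigD1 m) //= c0 cm (scheme_id schemeA).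
rewrite scalemx1 addrA big1 ?addr0 // => k /andP[k_neq0 km].
(* A class other than A_0 and A_m joins a to a vertex outside {a, b}, where column a of U(t)
   vanishes. *)
have [x Ak] := class_neighbour schemeA k a; rewrite -(Uxa x) // Ux.
have [x_a|_] := eqVneq x a.
  move/eqP: Ak; rewrite x_a (class_diag schemeA) (negPf k_neq0).
  by rewrite eq_sym oner_eq0.
have [x_b|_] := eqVneq x b.
  by move/eqP: Ak; rewrite x_b Am (negPf km) eq_sym oner_eq0.
by rewrite !mulr0 addr0 scale0r.
Qed.

(** The eigenvalues on the E_s determine U(t). Conversely, a vertex moved by the matching and its
    partner form a pair in D under either reading of D. *)
Lemma revival_eigenvalues P t :
  revival_at X D P t <-> exists alpha beta, [/\ 0 < t, beta != 0,
    forall s, cis (- t) ^ theta s = alpha + beta * sigma s & P alpha beta].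
Proof.
have UE s : transition X t *m E s = cis (- t) ^ theta s *: E s.
  rewrite (transition_spectral schemeA schemeE t X_spectral).
  exact: (sum_idem_mul schemeA schemeE).
have abE (alpha beta : R[i]) s : (alpha%:M + beta *: A q) *m E s =
    (alpha + beta * sigma s) *: E s.
  by rewrite mulmxDl mul_scalar_mx -scalemxAl matching_idem scalerA scalerDl.
split=> [[a [b [alpha [beta [Dab rev Pab]]]]]|
         [alpha [beta [t_gt0 beta_neq0 Uab Pab]]]].
  exists alpha, beta; case: (rev) => t_gt0 _ beta_neq0 _ _; split=> // s.
  apply: (scaler_idem_inj schemeE (s := s)).
  by rewrite -UE (revival_matrix Dab rev) abE.
have [f [Af fK] [a fa]] := matching_involution.
exists a, (f a), alpha, beta; split=> //.
  case: D_matching => [->|[_ ->] //]; by rewrite Af eqxx.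
split=> //; first by rewrite eq_sym.
  (* As sigma takes both signs, alpha + beta and alpha - beta are eigenvalues of U(t), of modulus
     1. *)
  have [r sigma_r] := sigma_neg1.
  have norm1 s : `|alpha + beta * sigma s| = 1.
    by rewrite -Uab normr_exprz1 ?normr_cis.
  have := parallelogram alpha beta.
  have := norm1 ord0; have := norm1 r; rewrite sigma_r sigma_ord0 mulr1 mulrN1.
  move=> -> ->; rewrite expr1n => norm2.
  by apply: (@mulfI _ 2); rewrite ?pnatr_eq0 // -norm2 mulr1.
have -> : transition X t = alpha%:M + beta *: A q.
  by apply: (eq_on_idem schemeA schemeE) => s; rewrite UE abE Uab.
rewrite mulmxDl mul_scalar_mx -scalemxAl; congr (_ + _ *: _).
rewrite -colE; apply/matrixP => x y; rewrite !mxE Af ord1 eqxx andbT.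
by rewrite (can2_eq fK fK).
Qed.

(** * Reduction to the single phase w = e^{-itg} *)

Variables (g : int) (m : nat).
Hypothesis g_def : g = gcd_diff0 theta.
Hypothesis hg_def : m%:Z * g = gcd_diff_same sigma theta.
Local Notation w t := (cis (- (t * g%:~R)) : R[i]).

(** z^(hg) = 1 makes z^theta constant on each of the sets sigma = 1 and sigma = -1; the last
    condition equates the two constants. *)
Lemma exprz_gcd_closed (z : R[i]) r : z != 0 -> sigma r = -1 ->
  z ^ (m%:Z * g) = 1 -> z ^ (theta r - theta ord0) = 1 -> z ^ g = 1.
Proof.
move=> z_neq0 sigma_r; rewrite hg_def g_def.
move=> /(exprz_gcd_diff_same _ _ z_neq0) zE /(exprz_eq_sub z_neq0) zr.
apply/(exprz_gcd_diff0 _ z_neq0) => s.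
have [s1|s1] := sigma_pm1 s.
  by apply: zE; rewrite s1 sigma_ord0.
by rewrite -zr; apply: zE; rewrite s1.
Qed.

Lemma gcd_diff0_dvd r : (g %| theta r - theta ord0)%Z.
Proof.
have [->|r_neq0] := eqVneq r ord0; first by rewrite subrr dvdz0.
by rewrite -opprB rpredN g_def; exact: biggcdz_dvd.
Qed.

(** The amplitudes solve alpha + beta = z^theta_0 and alpha - beta = z^theta_r. The condition w^m =
    1 is consistency with all other eigenvalues, and w != 1 is beta != 0. *)
Lemma revival_phase P t r : sigma r = -1 ->
  let z := cis (- t) in
  revival_at X D P t <-> [/\ 0 < t, w t ^+ m = 1, w t != 1 &
    P (z ^ theta ord0 * (1 + z ^ (theta r - theta ord0)) / 2)
      (z ^ theta ord0 * (1 - z ^ (theta r - theta ord0)) / 2)].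
Proof.
move=> sigma_r z; have z_neq0 : z != 0 := cis_neq0 _.
have z2_neq0 : 2 != 0 :> R[i] by rewrite pnatr_eq0.
have wE : w t = z ^ g by rewrite -cisMz mulNr.
have zr : z ^ theta r = z ^ theta ord0 * z ^ (theta r - theta ord0).
  by rewrite -expfzDr // addrC subrK.
rewrite revival_eigenvalues.
rewrite wE exprnP exprz_exp [g * _]mulrC.
split=> [[al [be [t_gt0 be_neq0 zE Pab]]]|[t_gt0 zG zg Pab]].
  have z0 : z ^ theta ord0 = al + be by rewrite zE sigma_ord0 mulr1.
  have z_r : z ^ theta r = al - be by rewrite zE sigma_r mulrN1.
  split=> //.
  - rewrite hg_def; apply/(exprz_gcd_diff_same _ _ z_neq0) => k l kl.
    by rewrite !zE kl.
  - apply: contra_neq be_neq0 => zg1.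
    have : z ^ theta ord0 = z ^ theta r.
      by apply: (exprz_gcd_diff0 theta z_neq0).1; rewrite -g_def.
    rewrite z0 z_r => /addrI /eqP; rewrite -addr_eq0 -mulr2n mulrn_eq0 /=.
    by move/eqP.
  - rewrite mulrDr mulrBr mulr1 -zr z0 z_r.
    have -> : (al + be + (al - be)) / 2 = al by field.
    by have -> : (al + be - (al - be)) / 2 = be by field.
exists (z ^ theta ord0 * (1 + z ^ (theta r - theta ord0)) / 2).
exists (z ^ theta ord0 * (1 - z ^ (theta r - theta ord0)) / 2).
split=> //.
  rewrite !mulf_neq0 ?invr_eq0 ?expfz_neq0 // subr_eq0 eq_sym.
  by apply: contra_neq zg; exact: exprz_gcd_closed sigma_r zG.
move: zG; rewrite hg_def => /(exprz_gcd_diff_same _ _ z_neq0) zE s.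
rewrite mulrDr mulrBr mulr1 -zr.
have [s1|s1] := sigma_pm1 s; rewrite s1.
  by rewrite (zE s ord0) ?s1 ?sigma_ord0 // -/z; field.
by rewrite (zE s r) ?s1 ?sigma_r // -/z; field.
Qed.

Lemma revival_anyP t :
  revival_at X D any_revival t <-> [/\ 0 < t, w t ^+ m = 1 & w t != 1].
Proof.
have [r sigma_r] := sigma_neg1.
by rewrite (revival_phase _ _ sigma_r); split=> [[]|[]].
Qed.

(* For delta = theta r - theta 0, g divides delta, and applying
   [exprz_gcd_closed] to z and to z ^ 2 replaces a discussion of the parity of
   delta / g. *)
Lemma perfect_transfer_phase t r : sigma r = -1 -> w t ^+ m = 1 -> w t != 1 ->
  cis (- t) ^ (theta r - theta ord0) = -1 <-> w t = -1.
Proof.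
move=> sigma_r; have wE : w t = cis (- t) ^ g by rewrite -cisMz mulNr.
set z : R[i] := cis (- t) in wE *; have z_neq0 : z != 0 := cis_neq0 _.
rewrite wE exprnP exprz_exp [g * _]mulrC => zG zg.
have sqr1 (k : int) : (z ^+ 2) ^ k = (z ^ k) ^+ 2.
  by rewrite !exprnP !exprz_exp mulrC.
have sqr_pm1 (x : R[i]) : x ^+ 2 = 1 -> x != 1 -> x = -1.
  by move/eqP; rewrite sqrf_eq1 => /orP[/eqP->|/eqP //]; rewrite eqxx.
split=> zk; apply: sqr_pm1 => //.
  rewrite -sqr1; apply: exprz_gcd_closed sigma_r _ _; first exact: expf_neq0.
    by rewrite sqr1 zG expr1n.
  by rewrite sqr1 zk sqrrN expr1n.
  rewrite -sqr1; apply: exprz_dvd_eq1 (gcd_diff0_dvd r) _.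
  by rewrite sqr1 zk sqrrN expr1n.
by apply: contra_neq zg; exact: exprz_gcd_closed.
Qed.

Lemma revival_perfectP t : revival_at X D perfect_transfer t <->
  [/\ 0 < t, w t ^+ m = 1 & w t = -1].
Proof.
have [r sigma_r] := sigma_neg1.
have alpha0 : cis (- t) ^ theta ord0 *
    (1 + cis (- t) ^ (theta r - theta ord0)) / 2 = 0 <->
    cis (- t) ^ (theta r - theta ord0) = -1.
  split=> [/eqP|->]; last by rewrite subrr mulr0 mul0r.
  rewrite !mulf_eq0 invr_eq0 pnatr_eq0 orbF (negPf (expfz_neq0 _ (cis_neq0 _))).
  by rewrite addrC addr_eq0 => /eqP.
rewrite (revival_phase _ _ sigma_r); split.
  by case=> t_gt0 wm w1 /alpha0 /(perfect_transfer_phase sigma_r wm w1).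
case=> t_gt0 wm w_N1; have w1 : w t != 1.
  by rewrite w_N1 oppr1_neq1.
split=> //; apply/alpha0; exact/(perfect_transfer_phase sigma_r wm w1).
Qed.

(** In [revival_phase] the amplitudes are functions of t, so the criterion for alpha = 0 can be
    negated at a fixed time. *)
Lemma revival_not_perfectP t : revival_at X D not_perfect_transfer t <->
  [/\ 0 < t, w t ^+ m = 1, w t != 1 & w t != -1].
Proof.
have [r sigma_r] := sigma_neg1.
have perfectE := revival_perfectP t.
rewrite (revival_phase _ _ sigma_r) in perfectE.
rewrite (revival_phase _ _ sigma_r); split.
  case=> t_gt0 wm w1 alpha_neq0; split=> //; apply: contra_neq alpha_neq0 => w_N1.
  by case: (perfectE.2 (And3 t_gt0 wm w_N1)).
case=> t_gt0 wm w1 w_N1; split=> //; apply: contra_neq w_N1 => alpha0.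
by case: (perfectE.1 (And4 t_gt0 wm w1 alpha0)).
Qed.

(** By [balanced_half], balance means x^2 = -1 for x = z^(theta_r - theta_0). When w^m = 1, the
    equations w^l = 1 and x^l = 1 are equivalent for every l; l = 4 and l = 2 transfer the condition
    between x and w. *)
Lemma revival_balancedP t : revival_at X D balanced t <->
  [/\ 0 < t, w t ^+ m = 1 & w t ^+ 2 = -1].
Proof.
have [r sigma_r] := sigma_neg1.
have wE : w t = cis (- t) ^ g by rewrite -cisMz mulNr.
have N1_neq1 := oppr1_neq1 R[i].
rewrite (revival_phase _ _ sigma_r); set z : R[i] := cis (- t) in wE *.
have z1 : `|z| = 1 := normr_cis _; have z_neq0 : z != 0 := cis_neq0 _.
have expz2 (k : int) (l : nat) : (z ^+ l) ^ k = (z ^ k) ^+ l.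
  by rewrite !exprnP !exprz_exp mulrC.
have gcd_closed (l : nat) : w t ^+ m = 1 ->
    (z ^ (theta r - theta ord0)) ^+ l = 1 -> w t ^+ l = 1.
  move=> wm zl; rewrite wE -expz2.
  apply: exprz_gcd_closed sigma_r _ _; first exact: expf_neq0.
    by rewrite expz2 mulrC -exprz_exp -wE -exprnP wm expr1n.
  by rewrite expz2.
have gcd_dvd (l : nat) : w t ^+ l = 1 -> (z ^ (theta r - theta ord0)) ^+ l = 1.
  rewrite wE -!expz2; exact: exprz_dvd_eq1 (gcd_diff0_dvd r).
have sqr_pm1 (x : R[i]) : x ^+ 4 = 1 -> x ^+ 2 != 1 -> x ^+ 2 = -1.
  rewrite (exprM x 2 2) => /eqP; rewrite sqrf_eq1.
  by move=> /orP[/eqP->|/eqP //]; rewrite eqxx.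
have balE := balanced_half (normr_exprz1 (theta ord0) z1)
  (normr_exprz1 (theta r - theta ord0) z1).
split=> [[t_gt0 wm w1 /balE bal]|[t_gt0 wm w2]].
  split=> //; apply: sqr_pm1.
    by apply: gcd_closed => //; rewrite (exprM _ 2 2) bal sqrrN expr1n.
  by apply: contra_neq N1_neq1 => /gcd_dvd; rewrite bal.
split=> //.
  by apply: contra_neq N1_neq1 => w1; rewrite -w2 w1 expr1n.
apply/balE/sqr_pm1.
  by apply: gcd_dvd; rewrite (exprM _ 2 2) w2 sqrrN expr1n.
by apply: contra_neq N1_neq1 => /(gcd_closed _ wm); rewrite w2.
Qed.

End Matching.

(** * From roots of unity to the divisibility of h *)

Theorem theorem3p5 (R : realType) (n d : nat)
  (A E : 'I_d.+1 -> 'M[R[i]]_n) (q : 'I_d.+1) (X : 'M[R[i]]_n)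
  (sigma : 'I_d.+1 -> R[i]) (theta : 'I_d.+1 -> int) (g h : int)
  (D : rel 'I_n)
  (hA : association_scheme A)
  (hE : scheme_idempotents A E)
  (hq : perm_order2_mx (A q))
  (hsigma : A q = \sum_s sigma s *: E s)
  (hX : graph_in_scheme A X)
  (htheta : forall s, X *m E s = (theta s)%:~R *: E s)
  (htheta_noninc : forall r s : 'I_d.+1, (r <= s)%N -> theta s <= theta r)
  (hg : g = gcd_diff0 theta)
  (hg_neq0 : g != 0)
  (hh : h * g = gcd_diff_same sigma theta)
  (* pairs of vertices: those matched by A_q, or, when A_q is the only class
     that is a permutation matrix of order two, all pairs *)
  (hD : (forall a b, D a b = (A q a b == 1)) \/
        ((forall j, perm_order2_mx (A j) -> j = q) /\ forall a b, D a b)) :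
  [/\ (* (a) *)
      h = 1 <-> (~ admits X D any_revival /\ ~ admits X D perfect_transfer),
      (* (b) *)
      (h != 0 -> (2 < h <-> admits X D not_perfect_transfer)) /\
      (2 < h ->
        min_time (revival_at X D any_revival) (2 * pi / (h * g)%:~R) /\
        min_time (revival_at X D not_perfect_transfer) (2 * pi / (h * g)%:~R)),
      (* (c) *)
      ((2 %| h)%Z <-> admits X D perfect_transfer) /\
      (h = 2 ->
        admits X D perfect_transfer /\ ~ admits X D not_perfect_transfer)
    & (* (d) *)
      (4 %| h)%Z <-> admits X D balanced].
Proof.
have g_gt0 : 0 < g by rewrite lt_def hg_neq0 hg; exact: biggcdz_ge0.
(* Both gcds are nonnegative, so h is a natural number m. It is 0 when eigenvalues with equal sigma
   all coincide, as for a single edge, and then w^m = 1 holds at all times. *)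
have : 0 <= h by rewrite -(pmulr_lge0 _ g_gt0) hh; exact: biggcdz_ge0.
case: h hh => // m hh _.
have gR_gt0 : 0 < g%:~R :> R by rewrite ltr0z.
have anyP := revival_anyP hA hE hq hsigma htheta hD hg hh.
have pstP := revival_perfectP hA hE hq hsigma htheta hD hg hh.
have npstP := revival_not_perfectP hA hE hq hsigma htheta hD hg hh.
have balP := revival_balancedP hA hE hq hsigma htheta hD hg hh.
pose w t : R[i] := cis (- (t * g%:~R)).
have w_at y : 0 < y -> 0 < y / g%:~R /\ w (y / g%:~R) = cis (- y).
  by move=> y_gt0; rewrite divr_gt0 // /w divfK ?gt_eqF.
have pi_gt0 := pi_gt0 R.
have N1_neq1 := oppr1_neq1 R[i].
have N1_inv : (-1)^-1 = -1 :> R[i] by rewrite invrN invr1.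
have cis_neq1 y : 0 < y < 2 * pi -> cis (- y) != 1 :> R[i].
  case/andP=> y_gt0 y_lt; apply/eqP => y1; have : cis y = 1.
    by rewrite -[cis y]invrK -cisN y1 invr1.
  by move/(cis_eq1_ge y_gt0); rewrite leNgt y_lt.
(* At this time w = e^{-2 pi i / m}. *)
have first_time : (1 < m)%N -> let t := 2 * pi / (m%:Z * g)%:~R : R in
    [/\ 0 < t, w t ^+ m = 1, w t != 1 & (2 < m)%N -> w t != -1].
  move=> m_gt1 t; have mR_gt0 : 0 < m%:R :> R by rewrite ltr0n; lia.
  have tE : t = 2 * pi / m%:R / g%:~R by rewrite /t rmorphM /= invfM mulrA.
  have y_gt0 : 0 < 2 * pi / m%:R :> R by rewrite divr_gt0 // mulr_gt0.
  have [t_gt0 wt] := w_at _ y_gt0; rewrite tE wt; split=> //.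
  - by rewrite exprnP -cisMz mulNr divfK ?gt_eqF // cisN cis_2pi invr1.
  - by rewrite cis_neq1 // y_gt0 ltr_pdivrMr // ltr_pMr ?mulr_gt0 // ltr1n.
  (* Here w = -1 would give w^2 = 1, but the doubled angle 4 pi / m is still below 2 pi. *)
  - move=> m_gt2; have y2_lt : 0 < 2 * (2 * pi / m%:R : R) < 2 * (pi : R).
      rewrite mulr_gt0 //= mulrA ltr_pdivrMr // [X in _ < X]mulrC.
      by rewrite ltr_pM2r ?mulr_gt0 // ltr_nat.
    apply: contraNneq (cis_neq1 _ y2_lt) => wN1.
    by rewrite mulrC -mulNr -[2]/(2%:~R) cisMz wN1 -exprnP sqrrN expr1n.
(* w^m = 1 says that the positive angle t m g is a full turn, hence at least 2 pi. *)
have any_time_ge t :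
    0 < t -> w t ^+ m = 1 -> (0 < m)%N -> 2 * pi / (m%:Z * g)%:~R <= t.
  move=> t_gt0 wm m_gt0; have mR_gt0 : 0 < m%:R :> R by rewrite ltr0n.
  rewrite ler_pdivrMr ?ltr0z ?mulr_gt0 //; apply: cis_eq1_ge.
    by rewrite mulr_gt0 // ltr0z mulr_gt0.
  apply: invr_inj; rewrite -cisN invr1 -wm exprnP -cisMz; congr cis.
  by rewrite rmorphM /= mulNr -mulrA [g%:~R * _]mulrC.
(* For m = 1 or 2 the m-th roots of unity are among 1 and -1. *)
have npst_gt2 : (0 < m)%N -> admits X D not_perfect_transfer -> (2 < m)%N.
  move=> m_gt0 [t /npstP[_]]; rewrite -/(w t) => wm w1 w_N1.
  case: m m_gt0 wm {hh anyP pstP npstP balP first_time any_time_ge} => [|[|[|]]] // _.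
    by rewrite expr1 => wt; rewrite wt eqxx in w1.
  by move/eqP; rewrite sqrf_eq1 (negPf w1) (negPf w_N1).
have even_pst : (2 %| m)%N <-> admits X D perfect_transfer.
  split=> [/dvdnP[k mk]|[t /pstP[_]]]; last first.
    by rewrite -/(w t) => wm w_N1; move: wm; rewrite w_N1 => /signr_eq1; rewrite dvdn2.
  (* At time pi / g the phase w is -1, whatever the value of h. *)
  have [t_gt0 wt] := w_at _ pi_gt0; exists (pi / g%:~R); apply/pstP.
  rewrite -/(w _) wt cisN cis_pi N1_inv; split=> //.
  by rewrite mk mulnC exprM sqrrN !expr1n.
split.
- split=> [[m1]|[no_any _]].
    have no_any : ~ admits X D any_revival.
      by case=> t /anyP[_]; rewrite m1 expr1 => -> /eqP.
    split=> // -[t [a [b [al [be [Dab rev _]]]]]]; apply: no_any.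
    by exists t, a, b, al, be.
  (* For h = 0 the time pi / g gives a revival; for h > 1 the time 2 pi / (hg) does. *)
  case: (ltngtP m 1%N) => [m0|m_gt1|-> //]; case: no_any.
    have [t_gt0 wt] := w_at _ pi_gt0; exists (pi / g%:~R); apply/anyP.
    rewrite -/(w _) wt cisN cis_pi N1_inv; split=> //.
    by have -> : m = 0%N by lia.
  have [t_gt0 wm w1 _] := first_time m_gt1.
  by eexists; apply/anyP; split; [exact: t_gt0| |].
- split=> [m_neq0|m_gt2].
    split=> [m_gt2|/npst_gt2]; last by lia.
    have [|t_gt0 wm w1 w_N1] := first_time _; first by lia.
    by eexists; apply/npstP; split; [exact: t_gt0| | |apply: w_N1; lia].
  have [|t_gt0 wm w1 w_N1] := first_time _; first by lia.
  split; split.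
  + exact/anyP.
  + by move=> u /anyP[u_gt0 wu _]; apply: any_time_ge => //; lia.
  + by apply/npstP; split=> //; apply: w_N1; lia.
  + by move=> u /npstP[u_gt0 wu _ _]; apply: any_time_ge => //; lia.
- split; first by rewrite -even_pst.
  by move=> [m2]; split=> [|/npst_gt2]; [apply/even_pst|]; rewrite m2 // => /(_ isT).
- split=> [/dvdnP[k /= mk]|[t /balP[_]]]; last first.
    by rewrite -/(w t) => wm /expr_eq1_dvd4 /(_ wm).
  (* At time pi / (2g) the phase is w = -i, whose square is -1. *)
  have y_gt0 : 0 < pi / 2 :> R by rewrite divr_gt0.
  have [t_gt0 wt] := w_at _ y_gt0; exists (pi / 2 / g%:~R); apply/balP.
  have w2 : cis (- (pi / 2)) ^+ 2 = -1 :> R[i].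
    by rewrite exprnP -cisMz mulNr divfK ?pnatr_eq0 // cisN cis_pi N1_inv.
  rewrite -/(w _) wt; split=> //.
  by rewrite mk mulnC exprM (exprM _ 2 2) w2 sqrrN !expr1n.
Qed.
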